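(* Let $\mathcal C\le\mathbb F_q^{n\times m}$ be a rank-metric code of dimension $k$ with associated $(q,m)$-polymatroid $P_{\mathcal C}=(E,\rho)$. Then $$R_{P_{\mathcal C}}(X_1,X_2,X_3,X_4)=\sum_{w=0}^{n}\sum_{a=0}^{\rho(E)}N^{(a)}_{\mathcal C}(n-w)X_1^{a}X_2^{mw-\rho(E)+a}g_w(X_3,X_4)$$ $$=\sum_{w=0}^{n}\sum_{a=0}^{k}\sum_{r=a}^{k}(-1)^{r-a}q^{\binom{r-a}{2}}\begin{bmatrix}r\\ a\end{bmatrix}_q B^{(r)}_{\mathcal C}(n-w)X_1^{a}X_2^{mw-k+a}g_w(X_3,X_4).$$
   Context: $q$ prime power, $E=\mathbb F_q^n$, $\mathcal L(E)$ its subspaces, $J^\perp$ orthogonal complement for the standard dot product. A rank-metric code is an $\mathbb F_q$-subspace $\mathcal C\le\mathbb F_q^{n\times m}$; $\mathrm{supp}(M)$ is the column space of $M$; $\mathcal C(J)=\{M\in\mathcal C\mid\mathrm{supp}(M)\subseteq J\}$; $\rho(J)=\rho_{\mathcal C}(J)=\dim\mathcal C-\dim\mathcal C(J^\perp)$ and $P_{\mathcal C}=(E,\rho_{\mathcal C})$. $g_\ell(X,Y)=\prod_{i=0}^{\ell-1}(X-q^iY)$. $R_P(X_1,X_2,X_3,X_4)=\sum_{A\le E}X_1^{\rho(E)-\rho(A)}X_2^{m\dim A-\rho(A)}g_{\dim A}(X_3,X_4)$. For $w\in\{0,\dots,n\}$, $a,r\in\{0,\dots,k\}$: $N^{(a)}_{\mathcal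 C}(w)=|\{W\le E\mid \dim W=w,\ \dim\mathcal C(W)=a\}|$ and $B^{(r)}_{\mathcal C}(w)=\sum_{W\le E,\dim W=w}|\{\mathcal D\le\mathcal C\mid\dim\mathcal D=r,\ \sum_{M\in\mathcal D}\mathrm{supp}(M)\le W\}|$. Gaussian coefficient $\begin{bmatrix}a\\ b\end{bmatrix}_q=\prod_{i=0}^{b-1}\frac{q^{a-i}-1}{q^{b-i}-1}$. *)

(* Defs.v *)
From HB Require Import structures.
From mathcomp Require Import all_boot all_order all_algebra.
From mathcomp Require Import mpoly zify.

Set Implicit Arguments.
Unset Strict Implicit.
Unset Printing Implicit Defensive.

Import GRing.Theory VectorInternalTheory.
Local Open Scope ring_scope.

(* Since F is finite, {vspace vT} is a finType: its elements are the subspaces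
   of vT, each counted once (they are encoded by canonical matrices). *)
HB.instance Definition _ (F : finFieldType) (vT : vectType F) :=
  [Finite of {vspace vT} by <:].

Section SpanPred.
Variables (F : finFieldType) (p q : nat).
Implicit Type P : pred 'M[F]_(p, q).

(* The subspace {M | P M}, for P closed under linear combinations; see
   mem_vspace_of. *)
Definition vspace_of P : {vspace 'M[F]_(p, q)} := <<enum P>>%VS.

Lemma mem_vspace_of P : submod_closed P -> vspace_of P =i P.
Proof.
move=> [P0 Plin] v; apply/idP/idP; last first.
  by move=> Pv; apply: memv_span; rewrite mem_enum.
move=> /(@coord_span _ _ _ (in_tuple (enum P))) ->.
apply: (big_ind (fun x => x \in P)) => //.
- by move=> x y Px Py; rewrite -[x]scale1r; apply: Plin.
- move=> i _; rewrite -[_ *: _]addr0; apply: Plin => //.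
  by rewrite -(mem_enum P) mem_nth.
Qed.
End SpanPred.

Section Codes.
Variables (F : finFieldType) (n m : nat).
Implicit Types (J A B : {vspace 'cV[F]_n}) (M : 'M[F]_(n, m))
  (C : {vspace 'M[F]_(n, m)}).

Definition dotp (u v : 'cV[F]_n) : F := \sum_i u i 0 * v i 0.

Definition perp J : {vspace 'cV[F]_n} :=
  vspace_of [pred v | [forall u : 'cV[F]_n, (u \in J) ==> (dotp u v == 0)]].

Definition supp M : {vspace 'cV[F]_n} := <<[seq col j M | j : 'I_m]>>%VS.

Definition shorten C J : {vspace 'M[F]_(n, m)} :=
  vspace_of [pred M | (M \in C) && (supp M <= J)%VS].

Lemma dotpDr u a v w : dotp u (a *: v + w) = a * dotp u v + dotp u w.
Proof.
rewrite /dotp mulr_sumr -big_split; apply: eq_bigr => i _ /=.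
by rewrite !mxE mulrDr mulrCA.
Qed.

Lemma perpP J v : reflect (forall u, u \in J -> dotp u v = 0) (v \in perp J).
Proof.
rewrite mem_vspace_of.
  apply: (iffP forallP) => [h u uJ|h u]; first by apply/eqP; exact: (implyP (h u)).
  by apply/implyP => /h ->.
split=> [|a x y /forallP hx /forallP hy]; apply/forallP => u; apply/implyP => uJ.
  by rewrite /dotp big1 // => i _; rewrite mxE mulr0.
by rewrite dotpDr (eqP (implyP (hx u) uJ)) (eqP (implyP (hy u) uJ)) mulr0 addr0.
Qed.

Lemma suppP M J : reflect (forall j, col j M \in J) (supp M <= J)%VS.
Proof.
apply: (iffP span_subvP) => [h j|h x /mapP[j _ ->]]; last exact: h.
by apply/h/map_f; rewrite mem_enum.
Qed.

Lemma mem_shorten C J M : (M \in shorten C J) = (M \in C) && (supp M <= J)%VS.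
Proof.
rewrite mem_vspace_of //; split=> [|a x y /andP[xC /suppP hx] /andP[yC /suppP hy]].
  rewrite inE mem0v; apply/suppP => j.
  by rewrite (_ : col j 0 = 0) ?mem0v //; apply/matrixP => i k; rewrite !mxE.
rewrite inE memvD ?memvZ //=; apply/suppP => j.
rewrite (_ : col j _ = a *: col j x + col j y) ?memvD ?memvZ //.
by apply/matrixP => i k; rewrite !mxE.
Qed.

Lemma shorten_sub C J : (shorten C J <= C)%VS.
Proof. by apply/subvP => M; rewrite mem_shorten => /andP[]. Qed.

Lemma shortenS C A B : (A <= B)%VS -> (shorten C A <= shorten C B)%VS.
Proof.
move=> sAB; apply/subvP => M; rewrite !mem_shorten => /andP[-> sMA].
exact: subv_trans sMA sAB.
Qed.

Lemma perpS A B : (A <= B)%VS -> (perp B <= perp A)%VS.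
Proof.
move=> /subvP sAB; apply/subvP => v /perpP h.
by apply/perpP => u uA; apply/h/sAB.
Qed.

Lemma perpD A B : perp (A + B) = (perp A :&: perp B)%VS.
Proof.
apply/eqP; rewrite eqEsubv subv_cap !perpS ?addvSl ?addvSr //=.
apply/subvP => v; rewrite memv_cap => /andP[/perpP hA /perpP hB].
apply/perpP => _ /memv_addP[x xA [y yB ->]].
have D : dotp (x + y) v = dotp x v + dotp y v.
  by rewrite /dotp -big_split; apply: eq_bigr => i _; rewrite mxE mulrDl.
by rewrite D hA ?hB ?addr0.
Qed.

(* Not truncated, by shorten_sub. *)
Definition code_rank C A : nat := (\dim C - \dim (shorten C (perp A)))%N.

Lemma code_rank_bound C A : (code_rank C A <= m * \dim A)%N.
Proof.
set d := \dim A; pose X := vbasis A.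
pose V : 'M[F]_(d, n) := \matrix_(i, l) (tnth X i) l 0.
pose f : 'Hom('M[F]_(n, m), 'M[F]_(d, m)) := linfun (mulmx V).
have sub : (C :&: lker f <= shorten C (perp A))%VS.
  apply/subvP => M; rewrite memv_cap memv_ker lfunE /= => /andP[MC /eqP VM0].
  rewrite mem_shorten MC; apply/suppP => j; apply/perpP => u.
  move=> /coord_vbasis ->.
  have D (I : Type) (r : seq I) (c : I -> F) (g : I -> 'cV[F]_n) w :
      dotp (\sum_(i <- r) c i *: g i) w = \sum_(i <- r) c i * dotp (g i) w.
    elim: r => [|i r IH].
      by rewrite !big_nil /dotp big1 // => l _; rewrite mxE mul0r.
    rewrite !big_cons -IH /dotp mulr_sumr -big_split; apply: eq_bigr => l _ /=.
    by rewrite !mxE mulrDl mulrA.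
  rewrite D big1 // => i _.
  suff -> : dotp (vbasis A)`_i (col j M) = (V *m M) i j by rewrite VM0 mxE mulr0.
  by rewrite mxE; apply: eq_bigr => l _; rewrite !mxE (tnth_nth 0).
have dimf : (\dim (f @: C) <= m * d)%N.
  by have := dimvS (subvf (f @: C)); rewrite dimvf dim_matrix mulnC.
rewrite /code_rank leq_subLR -(limg_ker_dim f C).
by rewrite leq_add // dimvS.
Qed.

Lemma code_rank_mono C A B : (A <= B)%VS -> (code_rank C A <= code_rank C B)%N.
Proof. by move=> sAB; apply/leq_sub2l/dimvS/shortenS/perpS. Qed.

Lemma code_rank_submod C A B :
  (code_rank C (A + B) + code_rank C (A :&: B) <= code_rank C A + code_rank C B)%N.
Proof.
have le J : (\dim (shorten C J) <= \dim C)%N by exact/dimvS/shorten_sub.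
suff h : (\dim (shorten C (perp A)) + \dim (shorten C (perp B)) <=
    \dim (shorten C (perp (A + B))) + \dim (shorten C (perp (A :&: B))))%N.
  rewrite /code_rank; move: h (le (perp A)) (le (perp B)) (le (perp (A + B))).
  by move: (le (perp (A :&: B))); lia.
rewrite -dimv_sum_cap addnC leq_add // dimvS //.
  apply/subvP => M; rewrite memv_cap !mem_shorten perpD subv_cap.
  by case/andP=> /andP[-> ->] /andP[_ ->].
by rewrite subv_add !shortenS // perpS ?capvSl ?capvSr.
Qed.

(* (q, m)-polymatroids on E = F_q^n *)
Record qmpolymatroid := QMPolymatroid {
  qmrank :> {vspace 'cV[F]_n} -> nat;
  qmrank_bound : forall A, (qmrank A <= m * \dim A)%N;
  qmrank_mono : forall A B, (A <= B)%VS -> (qmrank A <= qmrank B)%N;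
  qmrank_submod : forall A B,
    (qmrank (A + B) + qmrank (A :&: B) <= qmrank A + qmrank B)%N }.

Definition code_polymatroid C : qmpolymatroid :=
  QMPolymatroid (code_rank_bound C) (@code_rank_mono C) (code_rank_submod C).

Definition Nnum C (a w : nat) : nat :=
  #|[set W : {vspace 'cV[F]_n} | (\dim W == w) && (\dim (shorten C W) == a)]|.

Definition Bnum C (r w : nat) : nat :=
  \sum_(W : {vspace 'cV[F]_n} | \dim W == w)
    #|[set D : {vspace 'M[F]_(n, m)} |
        [&& (D <= C)%VS, \dim D == r & (\sum_(M in D) supp M <= W)%VS]]|.

End Codes.

Definition gpoly (K : comNzRingType) (q l : nat) (x y : K) : K :=
  \prod_(i < l) (x - q%:R ^+ i * y).

(* Meant for b <= a and K of characteristic 0. *)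
Definition gauss_binom (K : fieldType) (q a b : nat) : K :=
  \prod_(i < b) ((q%:R ^+ (a - i) - 1) / (q%:R ^+ (b - i) - 1)).

(* The exponents are integers, so that no truncated subtraction occurs; they
   are nonnegative by qmrank_mono and qmrank_bound. *)
Definition rank_gen (F : finFieldType) (n m : nat) (P : qmpolymatroid F n m)
    (K : fieldType) (x1 x2 x3 x4 : K) : K :=
  \sum_(A : {vspace 'cV[F]_n})
    x1 ^ ((P fullv)%:Z - (P A)%:Z) * x2 ^ ((m * \dim A)%N%:Z - (P A)%:Z)
    * gpoly #|F| (\dim A) x3 x4.

(* The ambient ring Q(X1, X2, X3, X4): individual terms of the expansion in the
   numbers Bnum may carry a negative power of X2. *)
Notation ratfun4 := {fraction {mpoly int[4]}}.

Definition X1 : ratfun4 := tofrac 'X_(inord 0).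
Definition X2 : ratfun4 := tofrac 'X_(inord 1).
Definition X3 : ratfun4 := tofrac 'X_(inord 2).
Definition X4 : ratfun4 := tofrac 'X_(inord 3).

(* Main.v *)
Require Import Defs.
From HB Require Import structures.
From mathcomp Require Import all_boot all_order all_algebra.
From mathcomp Require Import finfield mpoly ring zify.

Set Implicit Arguments.
Unset Strict Implicit.
Unset Printing Implicit Defensive.

Import GRing.Theory.
Local Open Scope ring_scope.

(** Since C(0) = 0, rho(E) = dim C, so with W = A^perp the exponents of X1 and X2
    in the term of A are dim C(W) and m dim A - dim C + dim C(W). As perp is an
    involution with dim A^perp = n - dim A, grouping the W by dimension and by
    dim C(W) gives the first expansion. For the second one, a subcode D of C
    has all its supports in W iff D <= C(W), so B^(r)(w) is the sum of
    [dim C(W), r]_q over the W of dimension w, and Gaussian inversion expresses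
    N^(a)(w) by the B^(r)(w). *)

(** * Gaussian coefficients and their inversion *)

Section GaussBinomial.
Variables (K : fieldType) (q : nat).
(** Keeps every denominator nonzero; over [ratfun4] it follows from characteristic 0. *)
Hypothesis q_not_root : forall i, (0 < i)%N -> q%:R ^+ i != 1 :> K.
Local Notation binq := (gauss_binom K q).

(** The q-factorial times (q - 1)^n; these extra powers cancel in Gaussian coefficients. *)
Definition qfact (n : nat) : K := \prod_(i < n) (q%:R ^+ i.+1 - 1).

(** Multiplied by [binq r a] at j = r - a, this is an entry of the inverse of the matrix of Gaussian
    coefficients. *)
Definition inversion_coef (j : nat) : K := (-1) ^+ j * q%:R ^+ 'C(j, 2).

Lemma qfact_neq0 n : qfact n != 0.
Proof. by apply/prodf_neq0 => i _; rewrite subr_eq0 q_not_root. Qed.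

Lemma qfactS n : qfact n.+1 = qfact n * (q%:R ^+ n.+1 - 1).
Proof. by rewrite /qfact big_ord_recr. Qed.

Lemma gauss_binomE b c : binq (b + c) b = qfact (b + c) / (qfact b * qfact c).
Proof.
have num : \prod_(i < b) (q%:R ^+ (b + c - i) - 1) * qfact c = qfact (b + c).
  rewrite addnC /qfact big_split_ord mulrC /=; congr (_ * _).
  rewrite (reindex_inj rev_ord_inj) /=; apply: eq_bigr => i _.
  by congr (_ ^+ _ - 1); have := ltn_ord i; lia.
have den : \prod_(i < b) (q%:R ^+ (b - i) - 1) = qfact b.
  rewrite /qfact (reindex_inj rev_ord_inj) /=; apply: eq_bigr => i _.
  by congr (_ ^+ _ - 1); have := ltn_ord i; lia.
have := qfact_neq0 b; have := qfact_neq0 c.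
by rewrite /gauss_binom prodf_div den -num => *; field; apply/andP.
Qed.

Lemma gauss_binom_small a b : (a < b)%N -> binq a b = 0.
Proof.
(* The factor of index i = a has numerator q^0 - 1 = 0. *)
move=> lt_ab; rewrite /gauss_binom (bigD1 (Ordinal lt_ab)) //=.
by rewrite subnn expr0 subrr !mul0r.
Qed.

Lemma gauss_binom0 a : binq a 0 = 1.
Proof. by rewrite /gauss_binom big_ord0. Qed.

Lemma gauss_binomnn a : binq a a = 1.
Proof.
have := gauss_binomE a 0.
rewrite addn0 => ->; have := qfact_neq0 a.
by rewrite /qfact big_ord0 mulr1; apply: divff.
Qed.

Lemma gauss_binomS a b :
  binq a.+1 b.+1 = q%:R ^+ b.+1 * binq a b.+1 + binq a b.
Proof.
have [lt_ab|le_ba] := ltnP a b.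
  by rewrite !gauss_binom_small ?mulr0 ?addr0 // ltnS ltnW.
have [c ->] : exists c, a = (b + c)%N by exists (a - b)%N; lia.
(* The case a = b is separate: [binq a b.+1] is then out of reach of [gauss_binomE] and vanishes. *)
case: c => [|c]; first by rewrite addn0 !gauss_binomnn gauss_binom_small ?mulr0 ?add0r.
have := (gauss_binomE b.+1 c.+1, gauss_binomE b.+1 c, gauss_binomE b c.+1).
rewrite !addSn !addnS => -[[-> ->] ->].
rewrite (qfactS (b + c).+1) (qfactS b) (qfactS c).
(* Once q^(b+c+2) is split as q^(b+1) q^(c+1), [field] sees an identity in these two powers and the
   q-factorials. *)
have -> : (b + c).+2 = (b.+1 + c.+1)%N by rewrite addSn addnS.
have := qfact_neq0 b; have := qfact_neq0 c.
have := q_not_root (ltn0Sn b); have := q_not_root (ltn0Sn c).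
rewrite -!(subr_eq0 _ 1) exprD => *.
by field; do ?[apply/andP; split].
Qed.

(** Both sides are the q-multinomial coefficient of b with parts a, r - a and b - r. *)
Lemma gauss_binom_trinomial b r a : (a <= r)%N -> (r <= b)%N ->
  binq r a * binq b r = binq b a * binq (b - a) (r - a).
Proof.
move=> le_ar le_rb.
have [i Er] : exists i, r = (a + i)%N by exists (r - a)%N; lia.
have [j Eb] : exists j, b = (a + i + j)%N by exists (b - r)%N; lia.
have -> : (b - a = i + j)%N by lia.
have -> : (r - a = i)%N by lia.
have Hb : b = (a + (i + j))%N by lia.
rewrite {2}Hb gauss_binomE Eb Er !gauss_binomE -addnA.
have := (qfact_neq0 a, qfact_neq0 i, qfact_neq0 j, qfact_neq0 (a + i), qfact_neq0 (i + j)).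
by case=> [[[[? ?] ?] ?] ?]; field; do ?[apply/andP; split].
Qed.

Lemma inversion_coefS j :
  inversion_coef j.+1 = - (inversion_coef j * q%:R ^+ j).
Proof. by rewrite /inversion_coef binS bin1 exprS exprD; ring. Qed.

(* By the Pascal rule the sum telescopes. *)
Lemma sum_inversion_gauss_binom N M : (N <= M)%N ->
  \sum_(0 <= j < M.+1) inversion_coef j * binq N j = (N == 0)%:R.
Proof.
case: N => [_|N lt_NM].
  rewrite big_nat_recl // gauss_binom0 [inversion_coef 0]mulr1 mulr1.
  by rewrite big1 ?addr0 // => j _; rewrite gauss_binom_small ?mulr0.
(* [f j] is the sum of the terms of index below [j]; the final value [f M.+1] contains [binq N M],
   which is 0 since now N < M. *)
pose f j := if j is i.+1 then inversion_coef i * q%:R ^+ i * binq N i else 0.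
rewrite (telescope_sumr_eq f) // => [|[_|j _]]; last 2 first.
- by rewrite /= !gauss_binom0 subr0 !mulr1.
- by rewrite /= gauss_binomS !inversion_coefS; ring.
by rewrite /= gauss_binom_small ?mulr0 ?subrr.
Qed.

(** The trinomial identity pulls out [binq b a] and leaves the alternating sum for b - a, which is 0
    unless b = a. Terms with r > b vanish, so any bound k >= b will do. *)
Lemma gauss_inversion k a b : (b <= k)%N ->
  \sum_(a <= r < k.+1) inversion_coef (r - a) * binq r a * binq b r
    = (b == a)%:R.
Proof.
move=> le_bk; have [lt_ba|le_ab] := ltnP b a.
  rewrite big_nat big1 ?ltn_eqF // => r /andP[le_ar _].
  by rewrite (gauss_binom_small (leq_trans lt_ba le_ar)) mulr0.
transitivity (binq b a *
    \sum_(0 <= j < (k - a).+1) inversion_coef j * binq (b - a) j).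
  rewrite -{1}[a]add0n big_addn subSn ?(leq_trans le_ab) // mulr_sumr.
  apply: eq_bigr => j _; rewrite addnK.
  have [le_jb|lt_bj] := leqP (j + a) b.
    by rewrite -mulrA gauss_binom_trinomial ?leq_addl // addnK; ring.
  by rewrite (gauss_binom_small lt_bj) (@gauss_binom_small _ j) ?mulr0 //; lia.
rewrite sum_inversion_gauss_binom ?leq_sub2r // subn_eq0.
have [->|ne_ba] := eqVneq b a; first by rewrite leqnn gauss_binomnn mulr1.
by rewrite leqNgt ltn_neqAle eq_sym ne_ba le_ab mulr0.
Qed.

End GaussBinomial.

(** * Counting the subspaces of given dimension *)

Section CountSubspaces.
Variables (F : finFieldType) (p s : nat).
Local Notation vT := 'M[F]_(p, s).
Local Notation q := #|F|.
Implicit Types V D : {vspace vT}.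

Definition free_tuples V r : {set r.-tuple vT} :=
  [set t : r.-tuple vT | free t && (<<t>> <= V)%VS].

(** A free tuple of length r + 1 is a free tail of length r preceded by a vector of V outside its
    span, which leaves q^(dim V) - q^r choices. Truncated subtraction is harmless: for r > dim V the
    factor i = dim V is already 0. *)
Lemma card_free_tuples V r :
  #|free_tuples V r| = (\prod_(i < r) (q ^ \dim V - q ^ i))%N.
Proof.
elim: r => [|r IHr].
  rewrite big_ord0; apply/eqP/cards1P; exists [tuple].
  by apply/setP => t; rewrite !inE tuple0 /= nil_free span_nil sub0v eqxx.
rewrite big_ord_recr /= -IHr -[LHS]sum1_card.
apply: etrans (partition_big
  (fun t : r.+1.-tuple vT => behead_tuple t : r.-tuple vT)
  (fun t => t \in free_tuples V r) _) _ => [t|] /=.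
  case/tupleP: t => x t; rewrite !inE /= free_cons span_cons subv_add.
  by case/andP=> /andP[_ ->] /andP[_ sub]; apply/andP.
rewrite -sum_nat_const; apply: eq_bigr => t; rewrite inE => /andP[free_t sub_tV].
rewrite sum1_card.
transitivity #|[set x | x \in V] :\: [set x | x \in <<t>>%VS]|; last first.
  rewrite cardsDS; last by apply/subsetP => x; rewrite !inE; exact: (subvP sub_tV).
  by rewrite !cardsE !card_vspace (eqP free_t) size_tuple.
rewrite -(card_imset _ (f := fun x => [tuple of x :: t])); last first.
  by move=> x y /(congr1 (@thead _ _)).
apply: eq_card => u; apply/idP/imsetP => [|[x]]; last first.
  rewrite !inE => /andP[nx xV] ->; rewrite -topredE /= inE free_cons nx free_t.
  by rewrite span_cons subv_add sub_tV -memvE xV /=; apply/eqP/val_inj.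
case/tupleP: u => x u; rewrite -topredE /= inE free_cons span_cons subv_add -memvE.
case/andP=> /andP[/andP[nx _] /andP[xV _]] /eqP Eu.
have {}Eu : u = t by rewrite -Eu; apply: val_inj.
by exists x; rewrite ?inE -?Eu ?nx ?xV //; apply: val_inj.
Qed.

(** Free tuples are grouped by their span: those spanning a given D of dimension r are exactly the
    free r-tuples in D. *)
Lemma card_subspaces V r :
  (#|[set D : {vspace vT} | (D <= V)%VS && (\dim D == r)]|
    * \prod_(i < r) (q ^ r - q ^ i) = \prod_(i < r) (q ^ \dim V - q ^ i))%N.
Proof.
rewrite -card_free_tuples -[in RHS]sum1_card.
apply/esym; apply: etrans (partition_big (fun t : r.-tuple vT => <<t>>%VS)
   (fun D => D \in [set D : {vspace vT} | (D <= V)%VS && (\dim D == r)]) _) _ => [t|] /=.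
  by rewrite !inE => /andP[/eqP-> ->]; rewrite size_tuple eqxx.
rewrite -sum_nat_const; apply: eq_bigr => D; rewrite inE => /andP[sDV /eqP dimD].
have := card_free_tuples D r; rewrite dimD => <-.
rewrite sum1_card; apply: eq_card => t; rewrite -topredE /= !inE.
have [free_t|//] := boolP (free t).
rewrite eqEdim (eqP free_t) size_tuple dimD leqnn andbT /=.
by apply/idP/idP => [/andP[]|tD] //; rewrite tD (subv_trans tD).
Qed.

Lemma card_subspaces_gauss (K : fieldType) V r :
    (forall i, (0 < i)%N -> q%:R ^+ i != 1 :> K) -> q%:R != 0 :> K ->
  #|[set D : {vspace vT} | (D <= V)%VS && (\dim D == r)]|%:R
    = gauss_binom K q (\dim V) r.
Proof.
move=> q_not_root q_neq0.
have [lt_Vr|le_rV] := ltnP (\dim V) r.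
  rewrite gauss_binom_small // (_ : [set _ | _] = set0) ?cards0 //.
  apply/setP => D; rewrite !inE; apply/andP => -[/dimvS + /eqP]; lia.
(* Each factor is q^i (q^(d-i) - 1); the powers q^i are the same for d = r and d = dim V, and
   cancel. *)
have E d : (r <= d)%N -> (\prod_(i < r) (q ^ d - q ^ i))%:R
    = \prod_(i < r) q%:R ^+ i * \prod_(i < r) (q%:R ^+ (d - i) - 1) :> K.
  move=> le_rd; rewrite natr_prod -big_split; apply: eq_bigr => i _ /=.
  have le_id : (i <= d)%N by rewrite (leq_trans _ le_rd) // ltnW.
  rewrite natrB ?leq_pexp2l ?(ltnW (finNzRing_gt1 F)) //.
  by rewrite mulrBr mulr1 -exprD subnKC // !natrX.
have /(congr1 (fun x => x%:R : K)) := card_subspaces V r.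
rewrite /= natrM !E // mulrCA => /mulfI H.
rewrite /gauss_binom prodf_div -H; last first.
  by apply/prodf_neq0 => i _; rewrite expf_neq0.
rewrite mulfK //; apply/prodf_neq0 => i _.
by rewrite subr_eq0 q_not_root // subn_gt0.
Qed.

End CountSubspaces.

(** * Orthogonal complements *)

Section Duality.
Variables (F : finFieldType) (n : nat).
Implicit Types A B : {vspace 'cV[F]_n}.

Lemma dotpC (u v : 'cV[F]_n) : dotp u v = dotp v u.
Proof. by apply: eq_bigr => i _; rewrite mulrC. Qed.

(** The complement is the kernel of multiplication by a matrix whose rows form a basis of A. Its
    rows being free, that map is onto, and rank-nullity applies. *)
Lemma dim_perp A : \dim (perp A) = (n - \dim A)%N.
Proof.
set d := \dim A; pose X := vbasis A.
pose V : 'M[F]_(d, n) := \matrix_(i, l) (tnth X i) l 0.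
have V_sum (c : 'I_d -> F) : (\row_i c i) *m V = (\sum_i c i *: X`_i)^T.
  apply/rowP => l; rewrite !mxE summxE; apply: eq_bigr => i _.
  by rewrite !mxE (tnth_nth 0).
have freeV : row_free V.
  apply: inj_row_free => u uV0; apply/rowP => i; rewrite mxE.
  have /freeP h := basis_free (vbasisP A); apply: h.
  apply: trmx_inj; rewrite trmx0 -V_sum -uV0; congr (_ *m _).
  by apply/rowP => j; rewrite mxE.
pose f : 'Hom('cV[F]_n, 'cV[F]_d) := linfun (mulmx V).
have limgf : (f @: fullv)%VS = fullv.
  apply/eqP; rewrite eqEsubv subvf; apply/subvP => y _.
  apply/memv_imgP; exists (pinvmx V *m y); rewrite ?memvf // lfunE /=.
  by rewrite mulmxA mulmxVp ?mul1mx.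
have kerf : perp A = lker f.
  have dotpX v i : (V *m v) i 0 = dotp X`_i v.
    by rewrite mxE; apply: eq_bigr => l _; rewrite mxE (tnth_nth 0).
  apply/vspaceP => v; rewrite memv_ker lfunE /=; apply/perpP/eqP => [h|h u].
    apply/colP => i; rewrite dotpX mxE; apply: h.
    by rewrite vbasis_mem // mem_nth // size_tuple.
  move/coord_vbasis->; rewrite dotpC.
  apply: (big_ind (fun x => dotp v x = 0)) => [|x y hx hy|i _].
  - by rewrite /dotp big1 // => i _; rewrite mxE mulr0.
  - by rewrite -[x]scale1r dotpDr hx hy mulr0 addr0.
  rewrite -[_ *: _]addr0 dotpDr dotpC -dotpX h mxE mulr0 add0r.
  by rewrite /dotp big1 // => l _; rewrite mxE mulr0.
have := limg_ker_dim f fullv.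
rewrite limgf capfv -kerf !dimvf /dim /= !muln1.
exact: canRL (addnK _).
Qed.

Lemma dim_cV A : (\dim A <= n)%N.
Proof. by have := dimvS (subvf A); rewrite dimvf /dim /= muln1. Qed.

(** Symmetry of the dot product gives one inclusion, and equality of dimensions the other. *)
Lemma perpK : involutive (@perp F n).
Proof.
move=> A; apply/esym/eqP; rewrite eqEdim !dim_perp subKn ?dim_cV // leqnn andbT.
by apply/subvP => v vA; apply/perpP => u /perpP h; rewrite dotpC h.
Qed.

Lemma dim_perp_eq A w : (w <= n)%N -> (\dim (perp A) == w) = (\dim A == n - w)%N.
Proof. by rewrite dim_perp; have := dim_cV A; lia. Qed.

End Duality.

(** * The rank generating function and the numbers N and B *)

Section CodeNumbers.
Variables (F : finFieldType) (n m : nat) (C : {vspace 'M[F]_(n, m)}).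
Local Notation q := #|F|.
Local Notation P := (code_polymatroid C).
(* path.shorten would shadow it. *)
Local Notation shorten := Defs.shorten.

Lemma shorten_perp_full : shorten C (perp fullv) = 0%VS.
Proof.
apply/eqP; rewrite -subv0; apply/subvP => M.
rewrite mem_shorten => /andP[_ /suppP h].
have /eqP : \dim (@perp F n fullv) = 0%N by rewrite dim_perp dimvf /dim /= muln1 subnn.
rewrite dimv_eq0 => /eqP E; rewrite memv0; apply/eqP/matrixP => i j.
by have := h j; rewrite E memv0 => /eqP/colP/(_ i); rewrite !mxE.
Qed.

Lemma code_rank_full : P fullv = \dim C.
Proof. by rewrite /= /code_rank shorten_perp_full dimv0 subn0. Qed.

Lemma dim_shorten J : (\dim (shorten C J) <= \dim C)%N.
Proof. exact/dimvS/shorten_sub. Qed.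

Lemma Nnum_sum (R : pzRingType) a w :
  (Nnum C a w)%:R
    = \sum_(W : {vspace 'cV[F]_n} | \dim W == w) (\dim (shorten C W) == a)%:R :> R.
Proof.
rewrite /Nnum -sum1_card natr_sum big_mkcond [RHS]big_mkcond.
by apply: eq_bigr => W _; rewrite inE; do 2!case: eqP.
Qed.

(** Each W is counted for a single a, namely dim C(W), which lies in the range as C(W) <= C. *)
Lemma sum_Nnum (R : pzRingType) (t : nat -> R) w :
  \sum_(0 <= a < (\dim C).+1) (Nnum C a w)%:R * t a
    = \sum_(W : {vspace 'cV[F]_n} | \dim W == w) t (\dim (shorten C W)).
Proof.
under eq_bigr do rewrite Nnum_sum mulr_suml.
rewrite exchange_big /=; apply: eq_bigr => W _; rewrite big_mkord.
have le : (\dim (shorten C W) < (\dim C).+1)%N by rewrite ltnS dim_shorten.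
rewrite (bigD1 (Ordinal le)) //= eqxx mul1r big1 ?addr0 // => i.
by rewrite -val_eqE /= eq_sym => /negbTE ->; rewrite mul0r.
Qed.

Lemma BnumE (K : fieldType) r w :
    (forall i, (0 < i)%N -> q%:R ^+ i != 1 :> K) -> q%:R != 0 :> K ->
  (Bnum C r w)%:R
    = \sum_(W : {vspace 'cV[F]_n} | \dim W == w)
        gauss_binom K q (\dim (shorten C W)) r.
Proof.
move=> q_not_root q_neq0; rewrite /Bnum natr_sum; apply: eq_bigr => W _.
rewrite -card_subspaces_gauss //; congr (_%:R); apply: eq_card => D; rewrite !inE.
rewrite andbCA [RHS]andbC; congr (_ && _).
apply/andP/subvP => [[/subvP DC /subv_sumP sD] M MD|h].
  by rewrite mem_shorten DC ?sD.
split; first by apply/subvP => M /h; rewrite mem_shorten => /andP[].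
by apply/subv_sumP => M /h; rewrite mem_shorten => /andP[].
Qed.

(** Inversion is applied to each W separately, with b = dim C(W): it expands the indicator of b = a
    into the Gaussian coefficients that [BnumE] sums. *)
Lemma Nnum_Bnum (K : fieldType) a w :
    (forall i, (0 < i)%N -> q%:R ^+ i != 1 :> K) -> q%:R != 0 :> K ->
  (Nnum C a w)%:R = \sum_(a <= r < (\dim C).+1)
    inversion_coef K q (r - a) * gauss_binom K q r a * (Bnum C r w)%:R.
Proof.
move=> q_not_root q_neq0; rewrite Nnum_sum.
under [RHS]eq_bigr do rewrite BnumE // mulr_sumr.
rewrite exchange_big /=; apply: eq_bigr => W _.
by rewrite gauss_inversion ?dim_shorten.
Qed.

Lemma rank_gen_Nnum (K : fieldType) (x1 x2 x3 x4 : K) :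
  rank_gen P x1 x2 x3 x4 =
    \sum_(0 <= w < n.+1) \sum_(0 <= a < (\dim C).+1)
      (Nnum C a (n - w))%:R * (x1 ^+ a
        * x2 ^ ((m * w)%N%:Z - (\dim C)%:Z + a%:Z) * gpoly q w x3 x4).
Proof.
(* [inord] never takes its default value here, since dim A <= n. *)
rewrite /rank_gen (partition_big (fun A => inord (\dim A) : 'I_n.+1) predT) //=.
rewrite big_mkord; apply: eq_bigr => w _; rewrite (sum_Nnum (fun a => _)).
have le_wn : (w <= n)%N by rewrite -ltnS.
(* Substitutes A = W^perp, so that rho(A) involves C(W) by [perpK]. *)
rewrite (reindex_inj (inv_inj (@perpK F n))) /=; apply: eq_big => [W|W].
  by rewrite -val_eqE /= inordK ?ltnS ?dim_cV // dim_perp_eq.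
rewrite -val_eqE /= inordK ?ltnS ?dim_cV // => /eqP dimW.
have := code_rank_full; rewrite /= => ->; rewrite /code_rank perpK dimW.
have := dim_shorten W; set d := \dim (shorten C W) => le_d.
(* By [le_d] the subtraction rho(A) = dim C - d is exact, so rho(E) - rho(A) = d. *)
by congr (_ * x2 ^ _ * _); [rewrite exprnP; congr (x1 ^ _)|]; lia.
Qed.

End CodeNumbers.

(** * Specialization to rational functions *)

Lemma ratfun4_natr_inj : injective (fun i : nat => i%:R : ratfun4).
Proof.
move=> i j /eqP; rewrite -!(rmorph_nat (@tofrac _)) tofrac_eq.
by rewrite -!(rmorph_nat (@mpolyC 4 int)) mpolyC_eq !natz => /eqP[].
Qed.

Theorem theorem4p13 (F : finFieldType) (n m k : nat)
    (C : {vspace 'M[F]_(n, m)}) (dimC : \dim C = k) :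
  let q := #|F| in
  let P := code_polymatroid C in
  rank_gen P X1 X2 X3 X4 =
    \sum_(0 <= w < n.+1) \sum_(0 <= a < (P fullv).+1)
      (Nnum C a (n - w))%:R * X1 ^+ a
        * X2 ^ ((m * w)%N%:Z - (P fullv)%:Z + a%:Z) * gpoly q w X3 X4
  /\
  rank_gen P X1 X2 X3 X4 =
    \sum_(0 <= w < n.+1) \sum_(0 <= a < k.+1) \sum_(a <= r < k.+1)
      (-1) ^+ (r - a) * q%:R ^+ 'C(r - a, 2) * gauss_binom ratfun4 q r a
        * (Bnum C r (n - w))%:R * X1 ^+ a
        * X2 ^ ((m * w)%N%:Z - k%:Z + a%:Z) * gpoly q w X3 X4.
Proof.
move=> q P; have q_gt1 : (1 < q)%N := finNzRing_gt1 F.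
have q_not_root i : (0 < i)%N -> q%:R ^+ i != 1 :> ratfun4.
  move=> i_gt0; rewrite -natrX -[1]/(1%:R) (inj_eq ratfun4_natr_inj).
  by rewrite -(expn0 q) eqn_exp2l // -lt0n.
have q_neq0 : q%:R != 0 :> ratfun4.
  by rewrite -[0]/(0%:R) (inj_eq ratfun4_natr_inj) -lt0n ltnW.
rewrite /P code_rank_full rank_gen_Nnum; split.
  by do 2!apply: eq_bigr => ? _; rewrite !mulrA.
rewrite dimC; apply: eq_bigr => w _; apply: eq_bigr => a _.
(* The two expansions differ only in the factor N^(a)(n - w), so it is replaced term by term. *)
rewrite (Nnum_Bnum _ _ _ q_not_root q_neq0) dimC mulr_suml.
by apply: eq_bigr => r _; rewrite /inversion_coef !mulrA.
Qed.
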